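(* Let $n\geq 1$ and $p\in(0,1)$. For any non-decreasing boolean function $f:\{0,1\}^n\to\{0,1\}$, we have $$E\big(|\mathcal P(f)|\big)\,\leq\,\sqrt{\frac{n\,E(f)}{p(1-p)}}\,.$$
   Context: Let $\Omega=\{0,1\}^n$, with elements $\omega=(\omega(1),\dots,\omega(n))$. The probability $P$ on $\Omega$ is the Bernoulli product measure of parameter $p$: $P(\omega)=\prod_{1\leq i\leq n}p^{\omega(i)}(1-p)^{1-\omega(i)}$, and $E$ is the expectation with respect to $P$, so $E(g)=\sum_{\omega\in\Omega}g(\omega)P(\omega)$. For $\omega\in\Omega$ and $i\in\{1,\dots,n\}$, $\omega^i$ (respectively $\omega_i$) denotes the configuration equal to $\omega$ except that its $i$-th component is set to $1$ (respectively to $0$). A boolean function is a function $f:\Omega\to\{0,1\}$; it is non-decreasing if $f(\omega_i)\leq f(\omega^i)$ for all $\omega\in\Omega$ and all $i\in\{1,\dots,n\}$. The coordinate $i$ is pivotal for $f$ in $\omega$ if $f(\omega^i)\neq f(\omega_i)$. The pivotal set $\mathcal P(f,\omega)\subset\{1,\dots,n\}$ is the set of the coordinates that are pivotal for $f$ in $\omega$; the variable $\omega$ is dropped inside expectations and probabilities, i.e. $\mathcal P(f)$ is the random set $\omega\mapsto\mathcal P(f,\omega)$, and $|\cdot|$ denotes cardinality. *)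

(* Defs.v *)
From mathcomp Require Import all_boot all_order all_algebra.
From mathcomp Require Import reals.

Set Implicit Arguments.
Unset Strict Implicit.
Unset Printing Implicit Defensive.

Import Order.TTheory GRing.Theory Num.Theory.
Local Open Scope ring_scope.

(* The values 0 and 1 are [false] and [true]; the coercion [nat_of_bool] turns
   them into numbers wherever one is needed. *)
Definition config (n : nat) := {ffun 'I_n -> bool}.

(* [set_coord w i true] is $\omega^i$ and [set_coord w i false] is $\omega_i$. *)
Definition set_coord (n : nat) (w : config n) (i : 'I_n) (b : bool) : config n :=
  [ffun j => if j == i then b else w j].

Definition nondecreasing_boolfun (n : nat) (f : config n -> bool) : Prop :=
  forall (w : config n) (i : 'I_n),
    (f (set_coord w i false) <= f (set_coord w i true))%N.

Definition pivotal_set (n : nat) (f : config n -> bool) (w : config n) :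
    {set 'I_n} :=
  [set i | f (set_coord w i true) != f (set_coord w i false)].

Definition bernoulli_weight (R : realType) (n : nat) (p : R) (w : config n) : R :=
  \prod_(i < n) (p ^+ w i * (1 - p) ^+ (1 - w i)%N).

Definition expect (R : realType) (n : nat) (p : R) (g : config n -> R) : R :=
  \sum_(w : config n) g w * bernoulli_weight p w.

(* Main.v *)
Require Import Defs.
From mathcomp Require Import all_boot all_order all_algebra.
From mathcomp Require Import reals.
From mathcomp Require Import ring.

Import Order.TTheory GRing.Theory Num.Theory.
Local Open Scope ring_scope.

(** With [X i = w i - p], averaging over the coordinate [i] alone gives
    [E (f * X i) = p (1 - p) P (i is pivotal)] for nondecreasing [f]. Summing
    over [i], [E #|P(f)| = E (f * S) / (p (1 - p))] where [S = \sum_i X i] has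
    second moment [n p (1 - p)], and Cauchy-Schwarz with [f ^ 2 = f]
    concludes. *)

Section SetCoord.
Context {n : nat}.
Implicit Types (w : config n) (i j : 'I_n) (b : bool).

Lemma set_coord_same w i b : set_coord w i b i = b.
Proof. by rewrite ffunE eqxx. Qed.

Lemma set_coord_other w i j b : j != i -> set_coord w i b j = w j.
Proof. by rewrite ffunE => /negbTE ->. Qed.

Lemma set_coord_id w i : set_coord w i (w i) = w.
Proof. by apply/ffunP => j; rewrite ffunE; case: eqP => [->|]. Qed.

Lemma set_coord_set w i b c : set_coord (set_coord w i b) i c = set_coord w i c.
Proof. by apply/ffunP => j; rewrite !ffunE; case: eqP. Qed.

Definition flip_coord i w : config n := set_coord w i (~~ w i).

Lemma flip_coordK i : involutive (flip_coord i).
Proof.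
by move=> w; rewrite /flip_coord set_coord_same set_coord_set negbK set_coord_id.
Qed.

End SetCoord.

Section Expectation.
Context {R : realType} {n : nat}.
Variable p : R.
Implicit Types (w : config n) (g h : config n -> R).

(** Isolates the factor at [i]: the remaining product does not depend on [b], so the two settings of
    coordinate [i] have weights in proportion [p] to [1 - p]. *)
Lemma bernoulli_weight_set w i b :
  bernoulli_weight p (set_coord w i b) =
  (if b then p else 1 - p) *
  \prod_(j < n | j != i) (p ^+ w j * (1 - p) ^+ (1 - w j)%N).
Proof.
rewrite /bernoulli_weight (bigD1 i) //= set_coord_same; congr (_ * _).
  by case: b; rewrite !(expr0, expr1, mulr1, mul1r).
by apply: eq_bigr => j ji; rewrite set_coord_other.
Qed.

Lemma eq_expect g h : g =1 h -> expect p g = expect p h.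
Proof. by move=> gh; apply: eq_bigr => w _; rewrite gh. Qed.

Lemma expectD g h : expect p (fun w => g w + h w) = expect p g + expect p h.
Proof. by rewrite /expect -big_split; apply: eq_bigr => w _; rewrite mulrDl. Qed.

Lemma expectZ c g : expect p (fun w => c * g w) = c * expect p g.
Proof. by rewrite /expect mulr_sumr; apply: eq_bigr => w _; rewrite mulrA. Qed.

Lemma expect_sum (I : finType) (g : I -> config n -> R) :
  expect p (fun w => \sum_i g i w) = \sum_i expect p (g i).
Proof.
by rewrite /expect exchange_big; apply: eq_bigr => w _; rewrite mulr_suml.
Qed.

Lemma expect1 : expect p (fun _ : config n => 1) = 1.
Proof.
rewrite /expect; under eq_bigr do rewrite mul1r.
(* The sum over configurations of a product factorizes into a product over coordinates of
   [p + (1 - p)]. *)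
rewrite -(bigA_distr_bigA 
  (fun (_ : 'I_n) (b : bool) => p ^+ b * (1 - p) ^+ (1 - b)%N)) /=.
by apply: big1 => i _; rewrite big_bool /= !(expr0, expr1, mulr1, mul1r) subrKC.
Qed.

(** Holds on each pair of configurations differing only at [i]: the averaged integrand is constant
    there, and the two weights are [p] and [1 - p] times a common factor. *)
Lemma expect_average i g :
  expect p g =
  expect p (fun w => p * g (set_coord w i true) +
                     (1 - p) * g (set_coord w i false)).
Proof.
(* Each orbit of the involution [flip_coord i] is represented by its member with value 1 at [i]. *)
have pairing (F : config n -> R) :
    \sum_(w : config n) F w = \sum_(w : config n | w i) (F w + F (flip_coord i w)).
  rewrite (bigID (fun w : config n => w i)) big_split /=; congr (_ + _).
  rewrite (reindex_inj (inv_inj (flip_coordK i))).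
  by apply: eq_bigl => w; rewrite set_coord_same negbK.
rewrite /expect !pairing; apply: eq_bigr => w wi.
rewrite /flip_coord wi !set_coord_set.
have -> : set_coord w i true = w by rewrite -{1}wi set_coord_id.
have := bernoulli_weight_set w i true; rewrite -{1}wi set_coord_id => ->.
by rewrite bernoulli_weight_set /=; ring.
Qed.

Hypotheses (p_ge0 : 0 <= p) (p_le1 : p <= 1).

Lemma expect_ge0 g : (forall w, 0 <= g w) -> 0 <= expect p g.
Proof.
move=> g0; apply: sumr_ge0 => w _; rewrite mulr_ge0 //; apply: prodr_ge0 => i _.
by rewrite mulr_ge0 // exprn_ge0 // subr_ge0.
Qed.

Lemma expect_Cauchy_Schwarz g h : 0 < expect p (fun w => h w ^+ 2) ->
  expect p (fun w => g w * h w) ^+ 2 <=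
  expect p (fun w => g w ^+ 2) * expect p (fun w => h w ^+ 2).
Proof.
set A := expect p (fun w => g w ^+ 2); set B := expect p (fun w => h w ^+ 2).
set C := expect p (fun w => g w * h w) => B_gt0.
(* Up to the factor [B], this is the residual of [g] after projection onto [h]; its second moment is
   [B * (A * B - C ^+ 2)], and [B > 0] can be cancelled. *)
have : 0 <= expect p (fun w => (B * g w - C * h w) ^+ 2).
  by apply: expect_ge0 => w; exact: sqr_ge0.
rewrite (_ : expect _ _ = B * (A * B - C ^+ 2)); first by rewrite pmulr_rge0 ?subr_ge0.
rewrite (@eq_expect _ (fun w => B ^+ 2 * g w ^+ 2 +
  (- (2 * B * C) * (g w * h w) + C ^+ 2 * h w ^+ 2))); last by move=> w; ring.
by rewrite !expectD !expectZ -/A -/B -/C; ring.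
Qed.

End Expectation.

Section CenteredCoordinates.
Context {R : realType} {n : nat}.
Variable p : R.
Implicit Types (w : config n) (i j : 'I_n).

Definition centered_coord i w : R := (w i)%:R - p.

(** Averaging over [i] gives [p (1 - p)^2 + (1 - p) p^2 = p (1 - p)] on the diagonal; off it, the
    factor at [j] is unaffected and the mean [p (1 - p) - (1 - p) p] of the factor at [i]
    vanishes. *)
Lemma expect_centered_mul i j :
  expect p (fun w => centered_coord i w * centered_coord j w) =
  (i == j)%:R * (p * (1 - p)).
Proof.
rewrite (expect_average _ i) eq_sym; case: (eqVneq j i) => [->|ji].
  (* Writing the constant as an expectation reduces the claim to a pointwise identity. *)
  rewrite mul1r -[RHS]mulr1 -[X in _ = _ * X](@expect1 R n p) -expectZ.
  by apply: eq_expect => w; rewrite /centered_coord !set_coord_same /=; ring.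
rewrite mul0r -[RHS](mul0r (expect p (fun _ : config n => 1))) -expectZ.
apply: eq_expect => w.
by rewrite /centered_coord !set_coord_same !set_coord_other //=; ring.
Qed.

Lemma expect_sum_centered_sqr :
  expect p (fun w => (\sum_i centered_coord i w) ^+ 2) = n%:R * (p * (1 - p)).
Proof.
rewrite (@eq_expect _ _ _ _ (fun w =>
  \sum_i \sum_j (centered_coord i w * centered_coord j w))); last first.
  by move=> w; rewrite expr2 mulr_suml; apply: eq_bigr => i _; rewrite mulr_sumr.
rewrite expect_sum (eq_bigr (fun=> p * (1 - p))) => [|i _].
  by rewrite sumr_const card_ord mulr_natl.
rewrite expect_sum (bigD1 i) //= expect_centered_mul eqxx mul1r big1 ?addr0 // => j ji.
by rewrite expect_centered_mul eq_sym (negbTE ji) mul0r.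
Qed.

(** After averaging over [i] the integrand is [p (1 - p)] times the increment of [f] from value 0 to
    value 1 at [i]; monotonicity excludes the increment -1, leaving the indicator of pivotality. *)
Lemma expect_mul_centered (f : config n -> bool) i :
  nondecreasing_boolfun f ->
  expect p (fun w => (f w)%:R * centered_coord i w) =
  p * (1 - p) * expect p (fun w => (i \in pivotal_set f w)%:R).
Proof.
move=> f_mono; rewrite (expect_average _ i) -expectZ; apply: eq_expect => w.
rewrite /centered_coord !set_coord_same inE.
by have := f_mono w i; do 2 case: (f _) => //=; move=> _; ring.
Qed.

Lemma expect_card_pivotal (f : config n -> bool) :
  nondecreasing_boolfun f ->
  p * (1 - p) * expect p (fun w => #|pivotal_set f w|%:R) =
  expect p (fun w => (f w)%:R * \sum_i centered_coord i w).
Proof.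
move=> f_mono.
under [RHS]eq_expect do rewrite mulr_sumr.
rewrite expect_sum; under [RHS]eq_bigr do rewrite expect_mul_centered //.
rewrite -mulr_sumr -expect_sum; congr (_ * _); apply: eq_expect => w.
by rewrite -sum1_card natr_sum big_mkcond; apply: eq_bigr => i _; case: ifP.
Qed.

End CenteredCoordinates.

Theorem theorem1p1 (R : realType) (n : nat) (p : R) (f : config n -> bool)
    (hn : (1 <= n)%N) (hp0 : 0 < p) (hp1 : p < 1)
    (hf : nondecreasing_boolfun f) :
  expect p (fun w : config n => #|pivotal_set f w|%:R)
    <= Num.sqrt (n%:R * expect p (fun w : config n => (f w)%:R) / (p * (1 - p))).
Proof.
have v_gt0 : 0 < p * (1 - p) by rewrite mulr_gt0 // subr_gt0.
(* Since [x <= |x| = sqrt (x ^+ 2)], it suffices to compare [x ^+ 2] with the radicand. Multiplying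
   twice by [p * (1 - p)] then gives the shape of Cauchy-Schwarz. *)
set x := expect _ _; apply: le_trans (ler_norm x) _.
rewrite -sqrtr_sqr ler_wsqrtr // ler_pdivlMr // -(ler_pM2r v_gt0).
have := @expect_Cauchy_Schwarz R n p (ltW hp0) (ltW hp1) (fun w => (f w)%:R)
  (fun w => \sum_i centered_coord p i w).
rewrite -expect_card_pivotal // -/x expect_sum_centered_sqr => CS.
(* The second moment [n p (1 - p)] is positive by [hn] and [v_gt0]. *)
have {CS} := CS _; rewrite mulr_gt0 ?ltr0n // => /(_ isT).
rewrite (@eq_expect _ _ _ (fun w => (f w)%:R ^+ 2) (fun w => (f w)%:R)); last first.
  by move=> w; case: (f w); rewrite ?expr1n ?expr0n.
by congr (_ <= _); ring.
Qed.
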